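(* Let $G$ be a finite connected graph and let $(X_n)_{n\ge0}$ be generated by the negative feedback algorithm from any starting node. Then there exists a positive integer $\mathcal G$, depending only on the number of nodes of $G$, the maximum degree of a node of $G$ and the length of the longest path in $G$, such that $T_C\le \mathcal G$ (for every realization).
   Context: $T_C$ is the smallest $n$ such that $X_0,X_1,\dots,X_n$ visit all nodes of the graph. Negative feedback algorithm: for nodes $i,j$ with $(i,j)$ an edge, let $N_{ij}^{(n)}$ be the number of times $m<n$ with $X_m=i,X_{m+1}=j$ (so $N_{ij}^{(0)}=0$). Let $Nmin_i^{(n)}=\min_{j:(i,j)\text{ edge}}N_{ij}^{(n)}$, $Smin_i^{(n)}=\{j:(i,j)\text{ edge}, N_{ij}^{(n)}=Nmin_i^{(n)}\}$, $Kmin_i^{(n)}=|Smin_i^{(n)}|$. If $X_n=i$, then given the past, $X_{n+1}$ is chosen uniformly at random from $Smin_i^{(n)}$ (probability $1/Kmin_i^{(n)}$ each, probability $0$ for other nodes). *)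

(* Defs.v *)
From HB Require Import structures.
From mathcomp Require Import all_boot all_order all_algebra.
From mathcomp Require Import all_classical all_reals all_analysis.

Set Implicit Arguments.
Unset Strict Implicit.
Unset Printing Implicit Defensive.

Import Order.TTheory GRing.Theory Num.Theory.

Local Open Scope classical_set_scope.
Local Open Scope nat_scope.

(* A graph on the nodes [V] is given by its adjacency relation [e], assumed
   symmetric, irreflexive and connected. *)
Definition connected_graph (V : finType) (e : rel V) : Prop :=
  [/\ symmetric e, irreflexive e & forall u v : V, connect e u v].

Definition max_degree (V : finType) (e : rel V) : nat :=
  \max_(v : V) #|[set w : V | e v w]%SET|.

(* Paths do not repeat nodes, so they have fewer than [#|V|] edges; length is
   counted in edges. *)
Definition longest_path (V : finType) (e : rel V) : nat :=
  \max_(k < #|V| | [exists v : V, exists p : k.-tuple V,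
                      path e v p && uniq (v :: p)]) k.

Section NegativeFeedback.
Variables (V : finType) (e : rel V).

(* For a trajectory [x] these quantities only involve [x 0, ..., x n]. *)
Definition Ncount (x : nat -> V) (n : nat) (i j : V) : nat :=
  #|[set m : 'I_n | (x m == i) && (x m.+1 == j)]%SET|.

(* The default value [n] is neutral, because [Ncount x n i j <= n]. *)
Definition Nmin (x : nat -> V) (n : nat) (i : V) : nat :=
  \big[minn/n]_(j : V | e i j) Ncount x n i j.

Definition Smin (x : nat -> V) (n : nat) (i : V) : {set V} :=
  [set j : V | e i j && (Ncount x n i j == Nmin x n i)]%SET.

Definition Kmin (x : nat -> V) (n : nat) (i : V) : nat := #|Smin x n i|.

Definition step_prob (R : realType) (x : nat -> V) (n : nat) (j : V) : R :=
  if j \in Smin x n (x n) then ((Kmin x n (x n))%:R^-1)%R else 0%R.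

(* The sequences of nodes all of whose steps have positive probability.  The
   guard [0 < Kmin ...] fails only at a node without neighbours, that is, in a
   connected graph, on the one-node graph, where no step can be chosen. *)
Definition nf_realization (v0 : V) (x : nat -> V) : Prop :=
  x 0 = v0 /\
  forall n, 0 < Kmin x n (x n) -> x n.+1 \in Smin x n (x n).

Definition history (T : Type) (X : nat -> T -> V) (n : nat) (h : nat -> V) :
  set T := [set w | forall m, m <= n -> X m w = h m].

(* The conditional law of [X n.+1] given the past is written in product form,
   so that histories of probability zero need no separate treatment.  Same
   guard as in [nf_realization]. *)
Definition nf_process (R : realType) (d : measure_display)
    (T : measurableType d) (P : probability T R) (v0 : V)
    (X : nat -> T -> V) : Prop :=
  [/\ forall n v, measurable (X n @^-1` [set v]),
      P (X 0 @^-1` [set v0]) = 1%E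
    & forall n (h : nat -> V) (j : V), 0 < Kmin h n (h n) ->
        P (history X n h `&` X n.+1 @^-1` [set j]) =
        (P (history X n h) * (step_prob R h n j)%:E)%E].

Definition covers (x : nat -> V) (n : nat) : Prop :=
  forall v : V, exists2 m, m <= n & x m = v.

Definition is_cover_time (x : nat -> V) (t : nat) : Prop :=
  covers x t /\ forall n, covers x n -> t <= n.

End NegativeFeedback.

(* Main.v *)
Require Import Defs.
From HB Require Import structures.
From mathcomp Require Import all_boot all_order all_algebra.
From mathcomp Require Import all_classical all_reals all_analysis.
From mathcomp Require Import zify.

(* The walk leaves each node [i] through its edges in a balanced way: the counts
   [N_ij], for [j] a neighbour of [i], differ by at most one.  With [D] the
   maximum degree and [w_i] one more than the number of visits to [i], this
   gives [w_i <= (D + 2) w_j] for every edge [(i, j)], hence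
   [w_i <= (D + 2) ^ #|V| w_j] for all [i] and [j].  If [j] has not been visited
   then [w_j = 1] and every node has been visited fewer than [(D + 2) ^ #|V|]
   times, which bounds the elapsed time.  A process satisfies this almost surely
   because its trajectories are almost surely realizations: each forbidden step
   after a given finite history has probability zero, and there are countably
   many of these. *)

Set Implicit Arguments.
Unset Strict Implicit.
Unset Printing Implicit Defensive.

Local Open Scope classical_set_scope.
Local Open Scope nat_scope.

Lemma NcountE (V : finType) (x : nat -> V) n i j :
  Ncount x n i j = \sum_(m < n) ((x m == i) && (x m.+1 == j)).
Proof.
rewrite /Ncount -sum1_card big_mkcond /=.
by apply: eq_bigr => m _; rewrite inE; case: ifP.
Qed.

Lemma NcountS (V : finType) (x : nat -> V) n i j :
  Ncount x n.+1 i j = Ncount x n i j + ((x n == i) && (x n.+1 == j)).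
Proof. by rewrite !NcountE big_ord_recr. Qed.

Lemma Ncount_le (V : finType) (x : nat -> V) n i j : Ncount x n i j <= n.
Proof. by rewrite -[leqRHS]card_ord max_card. Qed.

Lemma Nmin_le (V : finType) (e : rel V) (x : nat -> V) n i j :
  e i j -> Nmin e x n i <= Ncount x n i j.
Proof.
move=> eij; rewrite /Nmin; elim: (index_enum V) (mem_index_enum j) => // k s IHs.
rewrite inE big_cons => /orP[/eqP <-|/IHs js]; first by rewrite eij geq_minl.
by case: ifP => // _; exact: leq_trans (geq_minr _ _) js.
Qed.

(** The minimum over the neighbours is attained, so the guard in [nf_realization] holds at every
    node that has a neighbour. *)
Lemma Kmin_gt0 (V : finType) (e : rel V) (x : nat -> V) n i j :
  e i j -> 0 < Kmin e x n i.
Proof.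
move=> eij; apply/card_gt0P.
have [k eik kmin] := arg_minnP (fun k => Ncount x n i k) eij.
exists k; rewrite inE eik eqn_leq Nmin_le // andbT.
rewrite /Nmin; apply: (big_ind (leq (Ncount x n i k))) => [|a b ka kb|l]; first exact: Ncount_le.
  by rewrite leq_min ka.
exact: kmin.
Qed.

Lemma nf_step (V : finType) (e : rel V) (v0 : V) (x : nat -> V) n j :
  nf_realization e v0 x -> e (x n) j -> x n.+1 \in Smin e x n (x n).
Proof. by move=> [_ rx] /(Kmin_gt0 x n) /rx. Qed.

(** [N_ij] grows only when [j] is chosen from [i]; it was then minimal, hence at most [N_ik] before
    the step. *)
Lemma Ncount_balanced (V : finType) (e : rel V) (v0 : V) (x : nat -> V) n i j k :
  nf_realization e v0 x -> e i j -> e i k ->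
  Ncount x n i j <= (Ncount x n i k).+1.
Proof.
move=> rx eij eik; elim: n => [|n IHn]; first by rewrite !NcountE !big_ord0.
rewrite !NcountS; case: eqP => [xni|_] /=; last by rewrite !addn0.
case: (x n.+1 =P j) => [xj|_] /=; last by lia.
move: eij eik; rewrite -xni => eij eik.
have := nf_step rx eij; rewrite xj inE => /andP[_ /eqP ->].
by have := Nmin_le x n eik; lia.
Qed.

(** Time [n] is excluded, so that every visit counted here has its outgoing step counted in
    [Ncount x n]. *)
Definition visits (V : finType) (x : nat -> V) (n : nat) (i : V) : nat :=
  \sum_(m < n) (x m == i).

Lemma sum_visits (V : finType) (x : nat -> V) n : \sum_i visits x n i = n.
Proof.
rewrite exchange_big /= -[RHS]card_ord -sum1_card; apply: eq_bigr => m _.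
by rewrite (bigD1 (x m)) //= eqxx big1 // => i; rewrite eq_sym => /negPf ->.
Qed.

Lemma visits_gt0 (V : finType) (x : nat -> V) n i :
  0 < visits x n.+1 i -> exists2 m, m <= n & x m = i.
Proof.
rewrite lt0n sum_nat_eq0 negb_forall => /existsP[m]; rewrite /= eqb0 negbK.
by move=> /eqP; exists m; rewrite // -ltnS.
Qed.

(** Distinct steps from [i] to [j] arrive at [j] at distinct times among [1, ..., n]; the last of
    these calls for [n.+1]. *)
Lemma Ncount_le_visits (V : finType) (x : nat -> V) n i j :
  Ncount x n i j <= visits x n.+1 j.
Proof.
rewrite NcountE /visits big_ord_recl; apply/leq_trans/leq_addl.
by apply: leq_sum => m _; case: (x m == i).
Qed.

(** Since [i] has the neighbour [j], the guard holds at [i], and each visit is followed by a step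
    along exactly one edge. *)
Lemma visits_sum_Ncount (V : finType) (e : rel V) (v0 : V) (x : nat -> V) n i j :
  nf_realization e v0 x -> e i j ->
  visits x n i = \sum_(k | e i k) Ncount x n i k.
Proof.
move=> rx eij.
under eq_bigr do rewrite NcountE.
rewrite exchange_big; apply: eq_bigr => m _.
case: eqP => [xmi|_] /=; last by rewrite big1.
move: eij; rewrite -xmi => exj.
have := nf_step rx exj; rewrite inE => /andP[exx _].
by rewrite (bigD1 (x m.+1)) //= eqxx big1 // => k /andP[_]; rewrite eq_sym => /negPf ->.
Qed.

Lemma visits_edge (V : finType) (e : rel V) (v0 : V) (x : nat -> V) n i j :
  nf_realization e v0 x -> e i j ->
  (visits x n.+1 i).+1 <= (max_degree e + 2) * (visits x n.+1 j).+1.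
Proof.
move=> rx eij.
have vi : visits x n i <= max_degree e * (visits x n.+1 j).+1.
  rewrite (visits_sum_Ncount n rx eij).
  apply: (@leq_trans (\sum_(k | e i k) (visits x n.+1 j).+1)).
    apply: leq_sum => k eik; apply: leq_trans (Ncount_balanced n rx eik eij) _.
    by rewrite ltnS Ncount_le_visits.
  rewrite sum_nat_const leq_mul2r /= -cardsE.
  exact: (leq_bigmax (F := fun v : V => #|[set w : V | e v w]%SET|)).
(* A possible visit at time [n] and the successor on the left add at most 2; this is the 2 in
   [max_degree e + 2]. *)
rewrite {1}/visits big_ord_recr /= -/(visits x n i).
by case: (x n == i); nia.
Qed.

Lemma visits_path (V : finType) (e : rel V) (v0 : V) (x : nat -> V) n i p :
  nf_realization e v0 x -> path e i p ->
  (visits x n.+1 i).+1 <=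
    (max_degree e + 2) ^ size p * (visits x n.+1 (last i p)).+1.
Proof.
move=> rx; elim: p i => [|j p IHp] i /=; first by rewrite mul1n.
move=> /andP[eij pj]; apply: leq_trans (visits_edge n rx eij) _.
by rewrite expnS -mulnA leq_mul2l IHp ?orbT.
Qed.

Lemma nf_covers (V : finType) (e : rel V) (v0 : V) (x : nat -> V) :
  (forall u v, connect e u v) -> nf_realization e v0 x ->
  covers x (#|V| * (max_degree e + 2) ^ #|V|).
Proof.
move=> ce rx j; set D := max_degree e + 2; set n := #|V| * _.
apply: visits_gt0; rewrite lt0n; apply/eqP => vj0.
(* The [n.+1] visits at times [0, ..., n] would number at most [n], that is, [D ^ #|V|] for each
   node. *)
suff : n < n by rewrite ltnn.
rewrite -[X in X <= _](sum_visits x) {2}/n -sum_nat_const.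
apply: leq_sum => i _.
(* A path without repeated nodes has fewer than [#|V|] edges, which gives one exponent for all
   [i]. *)
have /connectP[q /shortenP[p ep up _] jE] := ce i j.
apply: ltnW; apply: leq_trans (visits_path n rx ep) _.
rewrite -jE vj0 muln1 leq_pexp2l ?addn2 //.
by apply: ltnW; rewrite (leq_trans _ (max_card (mem (i :: p)))) ?(card_uniqP up).
Qed.

Lemma covers_cover_time (V : finType) (x : nat -> V) n :
  covers x n -> exists2 t, is_cover_time x t & t <= n.
Proof.
move=> cn; have ex : exists m, `[< covers x m >] by exists n; apply/asboolP.
have [t /asboolP ct tmin] := ex_minnP ex.
by exists t; [split=> // m cm|]; apply: tmin; apply/asboolP.
Qed.

(** The steps counted before time [n] end by time [n]. Hence a finite code of the history, with
    default values afterwards, can replace the trajectory. *)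
Lemma eq_Smin (V : finType) (e : rel V) (x y : nat -> V) n i :
  (forall m, m <= n -> x m = y m) -> Smin e x n i = Smin e y n i.
Proof.
move=> xy; have NE k : Ncount x n i k = Ncount y n i k.
  by rewrite !NcountE; apply: eq_bigr => m _; rewrite !xy // ltnW.
by apply/setP => k; rewrite !inE /Nmin NE (eq_bigr _ (fun k _ => NE k)).
Qed.

Lemma measurable_history (V : finType) (d : measure_display)
    (T : measurableType d) (X : nat -> T -> V) n (h : nat -> V) :
  (forall m v, measurable (X m @^-1` [set v])) -> measurable (history X n h).
Proof.
move=> mX.
rewrite (_ : history X n h = \bigcap_(m in [set m | m <= n]) X m @^-1` [set h m]) //.
by apply: bigcap_measurable => //; exists 0.
Qed.

Lemma nf_process_realization (V : finType) (e : rel V) (v0 : V) (R : realType)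
    (d : measure_display) (T : measurableType d) (P : probability T R)
    (X : nat -> T -> V) :
  nf_process e P v0 X -> {ae P, forall w, nf_realization e v0 (X ^~ w)}.
Proof.
move=> [mX X0 Xstep].
have start0 : P.-negligible (~` (X 0 @^-1` [set v0])).
  apply/negligibleP; first exact: measurableC.
  by apply: (etrans (probability_setC P (mX 0 v0))); rewrite X0 subee.
(* A history up to time [n] is coded as the sequence of its [n.+1] nodes. *)
pose bad (sj : seq V * V) : set T :=
  let: (s, j) := sj in let n := (size s).-1 in let h := nth v0 s in
  if (0 < Kmin e h n (h n)) && (j \notin Smin e h n (h n))
  then history X n h `&` X n.+1 @^-1` [set j] else set0.
have bad0 sj : P.-negligible (bad sj).
  case: sj => s j; rewrite /bad.
  case: ifP => [/andP[K0 jS]|_]; last exact: negligible_set0.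
  apply/negligibleP; first by apply: measurableI => //; exact: measurable_history.
  by apply: (etrans (Xstep _ _ j K0)); rewrite /step_prob (negPf jS) mule0.
(* Countability of the pairs turns the bad events into a sequence; numbers that code no pair give
   the empty set. *)
pose code k := oapp bad set0 (unpickle k).
have code0 k : P.-negligible (code k).
  by rewrite /code; case: unpickle => [sj|] /=; [exact: bad0|exact: negligible_set0].
apply: negligibleS (negligibleU start0 (negligible_bigcup code0)) => w /= nrw.
have [Xw|] := eqVneq (X 0 w) v0; last by move=> /eqP; left.
right; apply: contrapT => nbad; apply: nrw; split=> // n K0.
apply: contrapT => /negP nS; apply: nbad.
(* The code is the history of [w] itself up to time [n], with its forbidden next node. *)
exists (pickle (mkseq (X ^~ w) n.+1, X n.+1 w)) => //.
have hE m : m <= n -> nth v0 (mkseq (X ^~ w) n.+1) m = X m w.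
  by move=> mn; rewrite nth_mkseq.
rewrite /code pickleK /= size_map size_iota /= hE //.
rewrite /Kmin (eq_Smin e (X n w) hE) -/(Kmin _ _ _ _) K0 nS /=.
by split=> // m /hE.
Qed.

Theorem theorem2 :
  exists G : nat -> nat -> nat -> nat,
    (forall a b c : nat, (0 < G a b c)%N) /\
    forall (V : finType) (e : rel V) (v0 : V), connected_graph e ->
      let g := G #|V| (max_degree e) (longest_path e) in
      (forall x : nat -> V, nf_realization e v0 x ->
         exists2 t : nat, is_cover_time x t & (t <= g)%N) /\
      (forall (R : realType) (d : measure_display) (T : measurableType d)
              (P : probability T R) (X : nat -> T -> V),
         nf_process e P v0 X ->
         {ae P, forall w : T,
            exists2 t : nat, is_cover_time (fun n => X n w) t & (t <= g)%N}).
Proof.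
(* The bound of [nf_covers]; the successor keeps it positive also for [a = 0]. *)
exists (fun a b _ => (a * (b + 2) ^ a).+1); split=> // V e v0 [_ _ ce] /=.
have bound x : nf_realization e v0 x ->
    exists2 t, is_cover_time x t &
      (t <= (#|V| * (max_degree e + 2) ^ #|V|).+1)%N.
  move=> /(nf_covers ce)/covers_cover_time[t tx tn].
  by exists t => //; exact: leqW.
split=> // R d T P X /nf_process_realization; apply: filterS => w.
exact: bound.
Qed.
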